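(* Let $n\ge 1$. For all integers $k\ge 0$ with $k \geq n-3$, the $k$-skeleton of the simplex on vertex set $[n]$ is extendably shellable.
   Context: A simplicial complex on $[n]=\{1,\dots,n\}$ is a collection of subsets (faces) of $[n]$ closed under taking subsets; a face of cardinality $r+1$ has dimension $r$; facets are inclusion-maximal faces; the complex is pure if all facets have the same dimension. The $k$-skeleton of the simplex on $[n]$ consists of all subsets of $[n]$ of dimension at most $k$ (so it is the whole simplex if $k\ge n-1$). A pure $r$-dimensional simplicial complex $\Delta$ is shellable if there is an ordering $F_1,\dots,F_s$ of its facets (a shelling) such that for all $j=2,\dots,s$ the complex $\big(\bigcup_{i=1}^{j-1}F_i\big)\cap F_j$ (the intersection of the complex generated by $F_1,\dots,F_{j-1}$ with the simplex $F_j$) is pure of dimension $r-1$. A subcomplex of a pure complex $\Delta$ here means a simplicial complex on the same vertex set whose set of facets is a subset of the set of facets of $\Delta$. A shellable complex $\Delta$ is extendably shellable if any shelling $F_1,\dots,F_h$ of a subcomplex of $\Delta$ can be extended to a shelling $F_1,\dots,F_h,F_{h+1},\dots,F_s$ of $\Delta$. *)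

(* Defs.v *)
From mathcomp Require Import all_boot all_order all_algebra.

Set Implicit Arguments.
Unset Strict Implicit.
Unset Printing Implicit Defensive.

Import GRing.Theory Num.Theory.

Local Open Scope ring_scope.

Section SimplicialComplexes.

Variable V : finType.
Implicit Types (D E : {set {set V}}) (F G : {set V}) (s t : seq {set V}).

(* The singletons need not be faces: V is only the ambient vertex set. *)
Definition simplicial_complex D : Prop :=
  forall F G, F \in D -> G \subset F -> G \in D.

(* Integer-valued, so that the empty face has dimension -1. *)
Definition face_dim F : int := #|F|%:Z - 1.

Definition facets D : {set {set V}} := [set F | maxset (mem D) F].

(* The condition [facets D != set0] only excludes the complex with no face at
   all, for which every r would otherwise be a dimension. *)
Definition pure_of_dim (r : int) D : Prop :=
  [/\ simplicial_complex D,
      facets D != set0 &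
      forall F, F \in facets D -> face_dim F = r].

Definition generated_complex s : {set {set V}} :=
  \bigcup_(F <- s) powerset F.

(* Indices start at 0: [nth set0 s j] is F_(j+1) and [take j s] is
   F_1, ..., F_j, for s = F_1, ..., F_(size s). *)
Definition shelling D s : Prop :=
  exists r : int,
    [/\ pure_of_dim r D,
        uniq s,
        s =i facets D &
        forall j : nat, (0 < j < size s)%N ->
          pure_of_dim (r - 1)
            (generated_complex (take j s) :&: powerset (nth set0 s j))].

Definition shellable D : Prop := exists s, shelling D s.

Definition subcomplex E D : Prop :=
  simplicial_complex E /\ facets E \subset facets D.

Definition extendably_shellable D : Prop :=
  shellable D /\
  forall E s, subcomplex E D -> shelling E s ->
    exists t, shelling D (s ++ t).

End SimplicialComplexes.

Definition skeleton (n k : nat) : {set {set 'I_n}} :=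
  [set F | face_dim F <= k%:Z].

(* Main.v *)
Require Import Defs.
From mathcomp Require Import all_boot all_order all_algebra.
From mathcomp Require Import zify.

(* Only skeletons whose facets have n - 2 elements need an argument. Encode a
   set s of such facets by the graph in which u and v are adjacent when the
   complement of {u, v} is not in s. A new facet, the complement of {u, v},
   may be appended to a shelling exactly when the common neighbours of the edge
   uv form a clique. Erasing such an edge preserves the property that every
   nonempty induced subgraph has a simplicial vertex (chordality), which holds
   for the complete graph. A chordal graph that still has an edge has a
   simplicial vertex with a neighbour, and any edge at this vertex can be
   erased next. *)

Set Implicit Arguments.
Unset Strict Implicit.
Unset Printing Implicit Defensive.

(** * Chordal graphs and the erasure of edges *)

Section ChordalGraphs.

Variable V : finType.
Implicit Types (e : rel V) (S K : {set V}) (u v x y z : V).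

Definition simplicial e S x :=
  {in S &, forall y z, e x y -> e x z -> y != z -> e y z}.

(** For finite simple graphs this is equivalent to having no induced cycle of length at least 4. *)
Definition chordal e :=
  forall S, S != set0 -> exists2 x, x \in S & simplicial e S x.

Definition clique e K := {in K &, forall x y, x != y -> e x y}.

Definition common_nbrs e u v := [set x | e x u && e x v].

(** A variant of Dirac's theorem on two nonadjacent simplicial vertices. If a simplicial vertex [y]
    of [S] lies in [K], induction applies to [S :\ y] and the clique of neighbours of [y]: the
    resulting [z] is not adjacent to [y], so it stays simplicial in [S] and lies outside [K]. *)
Lemma simplicial_avoiding_clique e S K : symmetric e -> chordal e ->
  clique e K -> ~~ (S \subset K) ->
  exists x, [/\ x \in S, x \notin K & simplicial e S x].
Proof.
move=> sym_e ch_e; have [m] := ubnP #|S|.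
elim: m S K => // m IHm S K ltSm clK nSK.
have [|y yS ySim] := ch_e S.
  by apply: contraNneq nSK => ->; rewrite sub0set.
have [yK|yNK] := boolP (y \in K); last by exists y.
pose N := [set z in S | e y z].
have clN : clique e N.
  by move=> a b; rewrite !inE => /andP[aS ya] /andP[bS yb]; apply: ySim.
(* If [y] is adjacent to all the rest of [S], then [S] is itself a clique and any of its vertices
   outside [K] will do. *)
have [sSN|nSN] := boolP (S :\ y \subset N).
  have [x xS xNK] := subsetPn nSK.
  have adj z : z \in S -> z != y -> e y z.
    by move=> zS zy; have := subsetP sSN z; rewrite !inE zy zS => /(_ isT).
  exists x; split=> // a b aS bS _ _ ab.
  have [ay|ay] := eqVneq a y; first by rewrite ay adj // eq_sym -ay.
  have [by_|by_] := eqVneq b y; first by rewrite by_ sym_e adj.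
  by apply: ySim; rewrite ?adj.
have [|z []] := IHm (S :\ y) N _ clN nSN.
  by move: ltSm; rewrite (cardsD1 y S) yS.
rewrite !inE => /andP[zy zS] zN zSim; rewrite zS /= in zN.
exists z; split=> //; first by apply: contra zN => zK; rewrite clK // eq_sym.
move=> a b aS bS za zb.
have nbr_neq c : e z c -> c != y by apply: contraTneq => ->; rewrite sym_e.
by apply: zSim; rewrite // !inE ?nbr_neq.
Qed.

(** Erasing [uv] spoils a simplicial vertex of [S] only if [u] and [v] are both among its neighbours
    in [S]. A vertex outside the clique formed by [u], [v] and their common neighbours avoids this;
    if [S] lies inside that clique, [u] is simplicial after the erasure. *)
Lemma chordal_erase_edge e e' u v : symmetric e -> irreflexive e ->
  chordal e -> e u v -> clique e (common_nbrs e u v) ->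
  (forall x y, e' x y = e x y && ([set x; y] != [set u; v])) ->
  chordal e'.
Proof.
move=> sym_e irr_e ch_e uv clC e'E S S0.
have sub_e' x y : e' x y -> e x y by rewrite e'E => /andP[].
have keep x y z : z \in [set x; y] -> z \notin [set u; v] -> e x y -> e' x y.
  by move=> zxy zuv xy; rewrite e'E xy; apply: contraNneq zuv => <-.
have [/andP[uS vS]|nuvS] := boolP ((u \in S) && (v \in S)); last first.
  have [x xS xSim] := ch_e S S0; exists x => // a b aS bS xa xb ab.
  rewrite e'E (xSim a b) ?sub_e' //=; apply: contraNneq nuvS => E.
  have sub_S : [set u; v] \subset S.
    by rewrite -E; apply/subsetP => c /set2P[] ->.
  by rewrite !(subsetP sub_S) ?set21 ?set22.
pose K := [set u; v] :|: common_nbrs e u v.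
have clK : clique e K.
  move=> a b; rewrite !inE.
  case/orP=> [aE|aC]; case/orP=> [bE|bC] ab; last by apply: clC; rewrite ?inE.
  - by case/orP: aE ab => /eqP->; case/orP: bE => /eqP->;
      rewrite ?eqxx // sym_e.
  - by case/andP: bC => bu bv; case/orP: aE => /eqP->; rewrite sym_e.
  - by case/andP: aC => au av; case/orP: bE => /eqP->.
have [sSK|nSK] := boolP (S \subset K).
  exists u => // a b aS bS ua ub ab.
  have nbr_u c : e' u c -> c \notin [set u; v].
    rewrite e'E => /andP[uc cv]; apply: contraNN cv => /set2P[] E; subst c.
      by rewrite irr_e in uc.
    by [].
  apply: (keep _ _ a); rewrite ?set21 ?nbr_u //.
  by apply: clK; rewrite // (subsetP sSK).
have [y [yS yNK ySim]] := simplicial_avoiding_clique sym_e ch_e clK nSK.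
exists y => // a b aS bS /sub_e' ya /sub_e' yb ab.
rewrite e'E ySim //=; apply: contraNneq yNK => E.
have adj c : c \in [set u; v] -> e y c by rewrite -E => /set2P[] ->.
by rewrite !inE !adj ?set21 ?set22 ?orbT.
Qed.

Lemma chordal_erasable_edge e a b : symmetric e -> chordal e -> e a b ->
  exists u v, e u v /\ clique e (common_nbrs e u v).
Proof.
move=> sym_e ch_e ab.
(* Isolated vertices are left out so that the simplicial vertex has a neighbour. *)
pose S := [set x | [exists y, e x y]].
have inS x y : e x y -> x \in S by rewrite inE => xy; apply/existsP; exists y.
have [|x] := ch_e S; first by apply/set0Pn; exists a; apply: inS ab.
rewrite inE => /existsP[y xy] xSim; exists x, y; split=> // p q.
rewrite !inE => /andP[px _] /andP[qx _].
by apply: xSim; rewrite ?(inS _ x) // sym_e.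
Qed.

End ChordalGraphs.

(** * Shellings as orders with linear quotients *)

Section LinearQuotients.

Variable V : finType.
Implicit Types (D : {set {set V}}) (F G L : {set V}) (s t : seq {set V}).

(** In terms of the squarefree monomials of the complements of the facets, the colon ideal of the
    earlier ones by that of [F] is generated by the monomials of the sets [F :\: G]; the condition
    says that variables generate it. *)
Definition attaches s F :=
  forall G, G \in s ->
  exists L x, [/\ L \in s, F :\: L = [set x] & x \notin G].

Definition linear_quotients s :=
  forall j, j < size s -> attaches (take j s) (nth set0 s j).

Lemma linear_quotients_rcons s F :
  linear_quotients (rcons s F) <-> linear_quotients s /\ attaches s F.
Proof.
split=> [lq|[lq att] j].
  split=> [j ltj|].
    have := lq j; rewrite size_rcons nth_rcons ltj -cats1 take_cat ltj.
    by apply; apply: ltnW.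
  have := lq (size s); rewrite size_rcons nth_rcons ltnn eqxx -cats1.
  by rewrite take_size_cat //; apply.
rewrite size_rcons ltnS nth_rcons -cats1 take_cat leq_eqVlt.
case: ltngtP => //= [ltj _|-> _]; first exact: lq.
by rewrite subnn cats0.
Qed.

Lemma mem_generated_complex s F :
  reflect (exists2 G, G \in s & F \subset G) (F \in generated_complex s).
Proof.
rewrite /generated_complex; apply: (iffP idP) => [|[G Gs sFG]].
  elim: s => [|G s IHs]; rewrite ?big_nil ?inE // big_cons inE.
  rewrite powersetE => /orP[sFG|/IHs[H Hs sFH]].
    by exists G; rewrite ?mem_head.
  by exists H; rewrite // inE Hs orbT.
by rewrite (big_rem G) //= inE powersetE sFG.
Qed.

Lemma face_sub_facet D F : F \in D -> exists2 M, M \in facets D & F \subset M.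
Proof.
by move=> FD; have [M maxM sFM] := @maxset_exists _ (mem D) F FD;
  exists M; rewrite ?inE.
Qed.

(** The facets of the intersection are the maximal sets among the [F :&: G]. Such a set has
    codimension one in [F] exactly when [F :\: G] is a singleton, and [x \notin G] says that
    [F :&: G] lies in [F :\ x], which is [F :&: L]. *)
Lemma pure_attaches s F (r : int) : s != [::] -> F \notin s ->
  {in s, forall G, #|G| = #|F|} -> face_dim F = r ->
  pure_of_dim (r - 1)%R (generated_complex s :&: powerset F) <->
  attaches s F.
Proof.
move=> s0 FNs szs dF; set D := _ :&: _.
have memD (M : {set V}) :
    reflect (M \subset F /\ exists2 G, G \in s & M \subset G) (M \in D).
  rewrite inE powersetE; apply: (iffP andP) => [[/mem_generated_complex]|];
  by [|case=> ? ?; split=> //; apply/mem_generated_complex].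
have proper L : L \in s -> 0 < #|F :\: L|.
  move=> Ls; rewrite card_gt0 setD_eq0; apply: contraNN FNs => sFL.
  suff -> : F = L by [].
  by apply/eqP; rewrite eqEcard sFL szs //=.
split=> [[_ _ pureD] G Gs|att].
  have [|M Mfac sGM] := @face_sub_facet D (G :&: F).
    by apply/memD; split; [apply: subsetIr | exists G; rewrite ?subsetIl].
  have := pureD M Mfac; move: Mfac; rewrite inE => /maxsetp/memD[sMF].
  case=> L Ls sML; rewrite -dF /face_dim => dM.
  have : #|F :\: L| == 1.
    rewrite eqn_leq proper // andbT.
    have := cardsID L F.
    have : #|M| <= #|F :&: L| by rewrite subset_leq_card // subsetI sMF.
    by lia.
  case/cards1P=> x FLx; exists L, x; split=> //.
  have : x \in F :\: L by rewrite FLx set11.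
  rewrite inE => /andP[xNL xF]; apply: contraNN xNL => xG.
  by rewrite (subsetP sML) // (subsetP sGM) // inE xG.
split.
- move=> A B /memD[sAF [G Gs sAG]] sBA; apply/memD.
  by split; [apply: subset_trans sAF | exists G; last apply: subset_trans sAG].
- case: s s0 {FNs szs proper att} @D memD => // G s _ D memD.
  have [|M Mfac _] := @face_sub_facet D set0; last by apply/set0Pn; exists M.
  apply/memD; rewrite sub0set; split=> //.
  by exists G; rewrite ?mem_head ?sub0set.
- move=> M; rewrite inE => /maxsetP[/memD[sMF [G Gs sMG]] maxM].
  have [L [x [Ls FLx xNG]]] := att G Gs.
  have sML : M \subset F :&: L.
    rewrite subsetI sMF; apply/subsetP=> y yM.
    apply: contraNT xNG => yNL; rewrite (subsetP sMG) //.
    suff /set1P <- : y \in [set x] by [].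
    by rewrite -FLx inE yNL (subsetP sMF).
  rewrite -(maxM _ _ sML); last first.
    by apply/memD; split; [apply: subsetIl | exists L; rewrite ?subsetIr].
  have := cardsID L F; rewrite FLx cards1 -dF /face_dim; lia.
Qed.

Lemma shelling_linear_quotients D s m : simplicial_complex D ->
  {in facets D, forall F, #|F| = m} ->
  shelling D s <->
  [/\ s != [::], uniq s, s =i facets D & linear_quotients s].
Proof.
move=> simD szD.
have step j : uniq s -> s =i facets D -> 0 < j < size s ->
  pure_of_dim (m%:Z - 1 - 1)%R
    (generated_complex (take j s) :&: powerset (nth set0 s j)) <->
  attaches (take j s) (nth set0 s j).
  move=> us sD /andP[j0 ltj].
  have Fs : nth set0 s j \in s by apply: mem_nth.
  have szF : #|nth set0 s j| = m by rewrite szD -?sD.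
  apply: pure_attaches; last by rewrite /face_dim szF.
  - by rewrite -size_eq0 size_take ltj -lt0n.
  - move: us; rewrite -{1}(cat_take_drop j s) (drop_nth set0) // cat_uniq /=.
    by case/and3P=> _; rewrite negb_or => /andP[].
  - by move=> G /mem_take Gs; rewrite szF szD -?sD.
split=> [[r [[_ fac0 dimD] us sD sh]]|[s0 us sD lq]].
  have rE : r = (m%:Z - 1)%R.
    by have [F FD] := set0Pn _ fac0; rewrite -(dimD F FD) /face_dim szD.
  split=> //.
    by apply: contraNneq fac0 => E; apply/eqP/setP=> F; rewrite -sD E inE.
  (* A shelling imposes no condition on the first facet, which attaches vacuously to the empty
     list. *)
  move=> [|j] ltj; first by rewrite take0.
  by apply/step => //; rewrite -rE; apply: sh.
exists (m%:Z - 1)%R; split=> //; last first.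
  by move=> j /[dup] ltj /andP[_ ltj']; apply/step => //; apply: lq.
split=> // [|F FD]; last by rewrite /face_dim szD.
by case: s s0 sD {us lq step} => // F s _ sD; apply/set0Pn; exists F;
  rewrite -sD mem_head.
Qed.

End LinearQuotients.

(** * Facets missing at most two vertices *)

Section SmallCodimension.

Variable V : finType.
Implicit Types (F G L : {set V}) (s t : seq {set V}).

(** Two distinct [m]-sets among at most [m.+1] points differ in a single point, so [G] serves as its
    own [L]. *)
Lemma attaches_codim1 s F m : #|V| <= m.+1 -> {in s, forall G, #|G| = m} ->
  #|F| = m -> F \notin s -> attaches s F.
Proof.
move=> leVm szs szF FNs G Gs.
have : #|F :\: G| == 1.
  have neqFG : 0 < #|F :\: G|.
    rewrite card_gt0 setD_eq0; apply: contraNN FNs => sFG.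
    by suff -> : F = G by []; apply/eqP; rewrite eqEcard sFG szF szs /=.
  have := subset_leq_card (subsetT (G :|: F)).
  have := cardsUI G F; have := cardsID G F; rewrite cardsT.
  by rewrite [F :&: G]setIC szF (szs G Gs); lia.
case/cards1P=> x FGx; exists G, x; split=> //.
by have : x \in F :\: G by [rewrite FGx set11]; rewrite inE => /andP[].
Qed.

Definition missing_edge s : rel V :=
  fun x y => (x != y) && (~: [set x; y] \notin s).

Lemma missing_edge_sym s : symmetric (missing_edge s).
Proof. by move=> x y; rewrite /missing_edge eq_sym setUC. Qed.

Lemma missing_edge_irr s : irreflexive (missing_edge s).
Proof. by move=> x; rewrite /missing_edge eqxx. Qed.

Lemma codim2P F m : #|V| = m.+2 -> #|F| = m ->
  exists u v, u != v /\ F = ~: [set u; v].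
Proof.
move=> cV cF; have : #|~: F| == 2 by have := cardsC F; rewrite cV cF; lia.
by case/cards2P=> u [v [uv E]]; exists u, v; split; rewrite // -E setCK.
Qed.

(** The sets [L] in [s] with [~: [set u; v] :\: L = [set x]] are the complements of non-edges [xw]
    with [w] in [[set u; v]], so they exist exactly when [x], outside [[set u; v]], is not a common
    neighbour. Hence attaching fails only at a non-edge [pq] between two common neighbours. *)
Lemma attaches_codim2 s u v m : #|V| = m.+2 -> {in s, forall G, #|G| = m} ->
  missing_edge s u v ->
  attaches s (~: [set u; v]) <->
  clique (missing_edge s) (common_nbrs (missing_edge s) u v).
Proof.
move=> cV szs /andP[uv uvNs]; split=> [att p q|cl G Gs].
  rewrite !inE => pC qC pq; rewrite /missing_edge pq; apply/negP => /att.
  case=> L [x [Ls Lx]]; have [a [b [ab EL]]] := codim2P cV (szs L Ls).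
  have xC : x \in [set p; q] -> missing_edge s x u && missing_edge s x v.
    by case/set2P=> ->.
  rewrite inE negbK => /xC{xC} /andP[/andP[_ xu] /andP[_ xv]].
  have inL c : (c == a) || (c == b) -> c \in [set u; v; x].
    move=> cab; have := congr1 (fun A : {set V} => c \in A) Lx.
    by rewrite EL !inE cab /= => <-; rewrite orbN.
  have xL : x \notin L by have := set11 x; rewrite -Lx inE => /andP[].
  rewrite EL !inE negbK in xL.
  (* This makes [xw] a non-edge, although [x] is a common neighbour of [u] and [v]. *)
  have [w] : exists2 w, w \in [set u; v] & L = ~: [set x; w].
    case/orP: xL => /eqP xE; [exists b|exists a]; rewrite ?EL ?xE //;
      [have := inL b; rewrite eqxx orbT | have := inL a; rewrite eqxx
      | by rewrite setUC].
      by move=> /(_ isT); rewrite !inE xE [b == a]eq_sym (negPf ab) orbF.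
    by move=> /(_ isT); rewrite !inE xE (negPf ab) orbF.
  by case/set2P=> -> E; rewrite -E Ls in xu xv.
have [p [q [pq EG]]] := codim2P cV (szs G Gs).
have goal x w : x \in [set p; q] -> x \notin [set u; v] -> w \in [set u; v] ->
    ~: [set x; w] \in s ->
  exists L x0, [/\ L \in s, ~: [set u; v] :\: L = [set x0] & x0 \notin G].
  move=> xpq xuv wuv Ls; exists (~: [set x; w]), x; split=> //.
    apply/setP=> y; rewrite in_setD in_setC [in RHS]inE negbK in_set2.
    rewrite in_setC.
    have [->|_] /= := eqVneq y x; first by [].
    by have [->|] := eqVneq y w; rewrite ?wuv.
  by rewrite EG inE negbK.
have Gpq : ~: [set p; q] \in s by rewrite -EG.
have Gqp : ~: [set q; p] \in s by rewrite setUC.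
(* If [pq] meets [uv], then [G] itself serves as [L], with [x] the endpoint of [pq] outside [uv]. *)
have [pF|pF] := boolP (p \in [set u; v]).
  apply: (goal q p); rewrite ?set22 //.
  apply: contraNN uvNs => qF; suff -> : [set u; v] = [set p; q] by [].
  apply/eqP; rewrite eq_sym eqEcard !cards2 uv pq andbT.
  by apply/subsetP=> c /set2P[]->.
have [qF|qF] := boolP (q \in [set u; v]); first exact: (goal p q (set21 _ _)).
have nonnbr x : x \in [set p; q] -> x \notin [set u; v] ->
    x \notin common_nbrs (missing_edge s) u v ->
  exists L x0, [/\ L \in s, ~: [set u; v] :\: L = [set x0] & x0 \notin G].
  move=> xpq xuv; have := xuv; rewrite in_set2 negb_or => /andP[xu xv].
  rewrite inE /missing_edge xu xv /= negb_and !negbK => /orP[].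
    by apply: goal; rewrite ?set21.
  by apply: goal; rewrite ?set22.
have [pC|/nonnbr] := boolP (p \in common_nbrs (missing_edge s) u v); last first.
  by apply; rewrite ?set21.
have [qC|/nonnbr] := boolP (q \in common_nbrs (missing_edge s) u v); last first.
  by apply; rewrite ?set22.
by have := cl p q pC qC pq; rewrite /missing_edge Gpq andbF.
Qed.

Lemma linear_quotients_chordal s m : #|V| = m.+2 ->
  {in s, forall G, #|G| = m} -> uniq s -> linear_quotients s ->
  chordal (missing_edge s).
Proof.
move=> cV; elim/last_ind: s => [_ _ _ S /set0Pn[x xS]|s F IHs szsF].
  (* The empty list gives the complete graph, where every vertex is simplicial. *)
  by exists x => // y z _ _ _ _ yz; rewrite /missing_edge yz.
rewrite rcons_uniq => /andP[FNs us] /linear_quotients_rcons[lq att].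
have szs : {in s, forall G, #|G| = m}.
  by move=> G Gs; apply: szsF; rewrite mem_rcons inE Gs orbT.
have [u [v [uv EF]]] : exists u v, u != v /\ F = ~: [set u; v].
  by apply: (codim2P cV); apply: szsF; rewrite mem_rcons mem_head.
subst F; have e_uv : missing_edge s u v by rewrite /missing_edge uv.
apply: (chordal_erase_edge (missing_edge_sym s) (missing_edge_irr s)
         (IHs szs us lq) e_uv).
  by apply/(attaches_codim2 cV).
move=> x y; rewrite /missing_edge mem_rcons in_cons negb_or.
by rewrite (inj_eq (can_inj (@setCK V))) [_ && (_ \notin s)]andbC andbA.
Qed.

(** The set found may differ from [F], which only witnesses that some [m]-set is still missing from
    the list. *)
Lemma exists_attaching s m : #|V| <= m.+2 -> {in s, forall G, #|G| = m} ->
  uniq s -> linear_quotients s ->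
  forall F, #|F| = m -> F \notin s ->
  exists F', [/\ #|F'| = m, F' \notin s & attaches s F'].
Proof.
rewrite leq_eqVlt ltnS => /orP[/eqP cV|leV] szs us lq F szF FNs; last first.
  by exists F; split=> //; apply: attaches_codim1 leV _ _ _.
have [a [b [ab EF]]] := codim2P cV szF.
have e_ab : missing_edge s a b by rewrite /missing_edge ab -EF.
have [u [v [e_uv cl]]] := chordal_erasable_edge (missing_edge_sym s)
  (linear_quotients_chordal cV szs us lq) e_ab.
have /andP[uv uvNs] := e_uv.
exists (~: [set u; v]); split=> //; last exact/(attaches_codim2 cV).
by have := cardsC [set u; v]; rewrite cV cards2 uv; lia.
Qed.

Lemma linear_quotients_extend s m : #|V| <= m.+2 ->
  {in s, forall G, #|G| = m} -> uniq s -> linear_quotients s ->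
  exists t, [/\ uniq (s ++ t), linear_quotients (s ++ t) &
                s ++ t =i [set F : {set V} | #|F| == m]].
Proof.
move=> leV; have [N] := ubnP (#|{set V}| - size s).
elim: N s => // N IHN s leN szs us lq.
have [/forallP all_s|/forallPn[F]] :=
  boolP [forall F : {set V}, (#|F| == m) ==> (F \in s)].
  exists [::]; rewrite cats0; split=> // F; rewrite inE.
  by apply/idP/idP => [/szs->|/(implyP (all_s F))].
rewrite negb_imply => /andP[/eqP szF FNs].
have [F' [szF' F'Ns att]] := exists_attaching leV szs us lq szF FNs.
have us' : uniq (rcons s F') by rewrite rcons_uniq F'Ns.
have lt_size : size s < #|{set V}|.
  by have := max_card (mem (rcons s F')); rewrite (card_uniqP us') size_rcons.
have [||||t] := IHN (rcons s F').
- by rewrite size_rcons; move: leN lt_size; lia.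
- by move=> G; rewrite mem_rcons inE => /orP[/eqP->//|/szs].
- by [].
- by apply/linear_quotients_rcons.
by rewrite cat_rcons => ext; exists (F' :: t).
Qed.

End SmallCodimension.

(** * Skeletons of the simplex *)

(** The minimum accounts for large [k], where the skeleton is the whole simplex and its only facet
    has [n] elements. *)
Lemma facets_skeleton n k :
  facets (skeleton n k) = [set F : {set 'I_n} | #|F| == minn n k.+1].
Proof.
have memD (F : {set 'I_n}) : (F \in skeleton n k) = (#|F| <= k.+1).
  by rewrite inE /face_dim; lia.
have leFn (F : {set 'I_n}) : #|F| <= n.
  by rewrite -[leqRHS]card_ord max_card.
apply/setP=> F; rewrite !inE; apply/maxsetP/eqP => /= [[]|szF].
  rewrite memD => leF maxF; apply/eqP; rewrite eqn_leq leq_min leFn leF /=.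
  rewrite leqNgt leq_min; apply/negP => /andP[ltFn ltFk].
  have [x xNF] : exists x, x \notin F.
    apply/existsP; rewrite -negb_forall; apply: contraTN ltFn => /forallP xF.
    by rewrite -leqNgt -{1}[n]card_ord -cardsT subset_leq_card //;
      apply/subsetP.
  have := maxF (x |: F); rewrite memD cardsU1 xNF => /(_ ltFk (subsetUr _ _)).
  by move=> E; rewrite -E setU11 in xNF.
rewrite memD szF geq_minr; split=> // G; rewrite memD => leG sFG.
by apply/esym/eqP; rewrite eqEcard sFG szF leq_min leFn.
Qed.

Theorem corollary4p4 (n k : nat) (hn : (1 <= n)%N) (hk : (n <= k + 3)%N) :
  extendably_shellable (skeleton n k).
Proof.
set m := minn n k.+1.
have facE := facets_skeleton n k; rewrite -/m in facE.
(* The bound on [k] enters here: a facet misses at most two vertices. *)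
have leV : #|'I_n| <= m.+2 by rewrite card_ord /m; lia.
have simD : simplicial_complex (skeleton n k).
  move=> F G; rewrite !inE /face_dim => leF /subset_leq_card; lia.
have szD : {in facets (skeleton n k), forall F : {set 'I_n}, #|F| = m}.
  by move=> F; rewrite facE inE => /eqP.
have extend (s : seq {set 'I_n}) :
    {in s, forall G : {set 'I_n}, #|G| = m} -> uniq s -> linear_quotients s ->
  exists t, shelling (skeleton n k) (s ++ t).
  move=> szs us lq; have [t [ust lqt memt]] :=
    linear_quotients_extend leV szs us lq.
  exists t; apply/(shelling_linear_quotients _ simD szD); split=> //.
    (* The empty face lies in some facet, so the extended list is not empty. *)
    have [F FD _] : exists2 M, M \in facets (skeleton n k) & set0 \subset M.
      by apply: face_sub_facet; rewrite inE /face_dim cards0.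
    by apply: contraTneq FD => E; rewrite facE -memt E.
  by move=> F; rewrite memt facE.
(* Shellability is the extension of the empty list. *)
split=> [|E s [simE sub_fac] sh]; first by apply: (extend [::]).
have szE : {in facets E, forall F : {set 'I_n}, #|F| = m}.
  by move=> F /(subsetP sub_fac)/szD.
have /(shelling_linear_quotients _ simE szE)[_ us sE lq] := sh.
by apply: extend => // F; rewrite sE => /szE.
Qed.
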